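(* Let $p\in[1,+\infty)$ and let $\mathbf w=(w_n)_{n\in\mathbb Z}$ be a bounded sequence of positive real numbers. Let $B_{\mathbf w}$ be the bilateral weighted shift on $\ell^p(\mathbb Z)$ defined by $B_{\mathbf w}(e_n)=w_ne_{n-1}$ for $n\in\mathbb Z$. The following assertions are equivalent. (i) $B_{\mathbf w}$ is frequently hypercyclic on $\ell^p(\mathbb Z)$; (ii) $B_{\mathbf w}$ is $\mathcal U$-frequently hypercyclic on $\ell^p(\mathbb Z)$; (iii) the series $\sum_{n\geq 1}\frac{1}{(w_1\cdots w_n)^p}$ and $\sum_{n<0}(w_{-1}\cdots w_{n})^p$ are convergent.
   Context: $(e_n)_{n\in\mathbb Z}$ is the standard basis of $\ell^p(\mathbb Z)$. For $n<0$, $w_{-1}\cdots w_n$ denotes the product $w_{-1}w_{-2}\cdots w_n$. For $A\subset\mathbb Z_+=\{0,1,2,\dots\}$ let $A(n)=\{a\in A: a\le n\}$, $\underline d(A)=\liminf_{n\to+\infty}\frac{\#A(n)}{n}$ (lower density) and $\bar d(A)=\limsup_{n\to+\infty}\frac{\#A(n)}{n}$ (upper density). A bounded operator $T$ on a Banach space $X$ is frequently hypercyclic (resp. $\mathcal U$-frequently hypercyclic) if there is a vector $x\in X$ such that for every nonempty open $U\subset X$ the set $\{n\in\mathbb Z_+: T^nx\in U\}$ has positive lower density (resp. positive upper density). *)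

(* Defs.v *)
From HB Require Import structures.
From mathcomp Require Import all_boot all_order all_algebra.
From mathcomp Require Import complex.
From mathcomp Require Import all_classical all_reals all_analysis.
From mathcomp Require Import ring lra.
Set Implicit Arguments.
Unset Strict Implicit.
Unset Printing Implicit Defensive.
Import Order.TTheory GRing.Theory Num.Theory.
Import numFieldNormedType.Exports.
Local Open Scope classical_set_scope.
Local Open Scope ring_scope.

(* The sequence space may be taken over the real or over the complex scalars;
   both are covered uniformly by a parameter k. *)
Variant scalars := RealScalars | ComplexScalars.

Definition scalar (R : realType) (k : scalars) : numFieldType :=
  match k with RealScalars => R | ComplexScalars => R[i] end.

Definition of_real (R : realType) (k : scalars) : R -> scalar R k :=
  match k with
  | RealScalars => fun x => x
  | ComplexScalars => fun x => x%:C%C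
  end.
Arguments of_real {R} k.

(* The norm of the field R[i] takes its (real) values in R[i]; [modulus] is the
   same absolute value with codomain R, see [of_real_modulus]. *)
Definition modulus (R : realType) (k : scalars) : scalar R k -> R :=
  match k with
  | RealScalars => fun x => `|x|
  | ComplexScalars => fun z => complex.Re (`|z| : R[i])
  end.
Arguments modulus {R k}.

Section scalar_theory.
Context {R : realType} {k : scalars}.
Implicit Types (x y : R) (z t : scalar R k).

Lemma of_real_modulus z : of_real k (modulus z) = `|z|.
Proof. by case: k z. Qed.

Lemma of_real_inj : injective (of_real k : R -> _).
Proof. by case: k => //= x y []. Qed.

Lemma of_real0 : of_real k (0 : R) = 0.
Proof. by case: k. Qed.

Lemma of_real1 : of_real k (1 : R) = 1.
Proof. by case: k. Qed.

Lemma of_realD x y : of_real k (x + y) = of_real k x + of_real k y.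
Proof. by case: k => //=; rewrite rmorphD. Qed.

Lemma of_realM x y : of_real k (x * y) = of_real k x * of_real k y.
Proof. by case: k => //=; rewrite rmorphM. Qed.

Lemma ler_of_real x y : (of_real k x <= of_real k y) = (x <= y).
Proof. by case: k => //=; rewrite lecR. Qed.

Lemma modulus_of_real x : modulus (of_real k x) = `|x|.
Proof. by case: k => //=; rewrite expr0n/= addr0 sqrtr_sqr. Qed.

Lemma modulus_ge0 z : 0 <= modulus z.
Proof. by rewrite -ler_of_real of_real0 of_real_modulus. Qed.

Lemma modulus0 : modulus (0 : scalar R k) = 0.
Proof. by apply: of_real_inj; rewrite of_real_modulus of_real0 normr0. Qed.

Lemma modulus_eq0 z : modulus z = 0 -> z = 0.
Proof.
move=> z0; apply/eqP; rewrite -normr_eq0 -of_real_modulus z0.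
by rewrite of_real0.
Qed.

Lemma modulusM z t : modulus (z * t) = modulus z * modulus t.
Proof.
by apply: of_real_inj; rewrite of_realM !of_real_modulus normrM.
Qed.

Lemma ler_modulusD z t : modulus (z + t) <= modulus z + modulus t.
Proof.
by rewrite -ler_of_real of_realD !of_real_modulus ler_normD.
Qed.

End scalar_theory.

Section real_facts.
Context {R : realType}.

Lemma esumZl (T : choiceType) (c : R) (a : T -> R) : 0 <= c ->
    (forall i, 0 <= a i) ->
  (\esum_(i in setT) (c * a i)%:E <= c%:E * \esum_(i in setT) (a i)%:E)%E.
Proof.
move=> c0 a0; rewrite ge_ereal_sup => //= _ [X [finX XI]] <-.
have -> : (\sum_(x \in X) (c * a x)%:E = c%:E * \sum_(x \in X) (a x)%:E)%E.
  by rewrite ge0_mule_fsumr// => i; rewrite lee_fin.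
by rewrite lee_wpmul2l ?lee_fin// esum_ge//; exists X.
Qed.

Lemma powRD_conv (p a b u v : R) : 1 <= p -> 0 < a -> 0 < b -> 0 <= u ->
    0 <= v ->
  (u + v) `^ p <= (a + b) `^ p * (a / (a + b) / a `^ p) * u `^ p +
                  (a + b) `^ p * (b / (a + b) / b `^ p) * v `^ p.
Proof.
move=> p1 a0 b0 u0 v0.
have ab0 : 0 < a + b by rewrite addr_gt0.
have t01 : 0 <= a / (a + b) <= 1.
  apply/andP; split; first by rewrite divr_ge0 ?ltW.
  by rewrite ler_pdivrMr// mul1r lerDl ltW.
pose t := Itv01 (andP t01).1 (andP t01).2.
have mem (x : R) : 0 <= x -> x \in (`[0, +oo[%classic : set R).
  by move=> x0; rewrite inE/= in_itv/= x0.
have := convex_powR p1 t (mem _ (divr_ge0 u0 (ltW a0)))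
                         (mem _ (divr_ge0 v0 (ltW b0))).
rewrite !convRE /= /unstable.onem => H.
have tE : 1 - a / (a + b) = b / (a + b) by field; rewrite gt_eqF.
rewrite tE in H.
have uvE : a / (a + b) * (u / a) + b / (a + b) * (v / b) = (u + v) / (a + b).
  by field; rewrite !gt_eqF.
rewrite [X in X `^ _ <= _]convRE /= /unstable.onem tE uvE in H.
have HV (x : R) : 0 < x -> (x^-1) `^ p = (x `^ p)^-1.
  by move=> x0; rewrite -(powR_inv1 (ltW x0)) -powRrM mulN1r powRN.
have {H} := ler_wpM2l (powR_ge0 (a + b) p) H.
rewrite !powRM ?invr_ge0 ?addr_ge0 ?(ltW a0) ?(ltW b0)// !HV// => H.
have abp : (a + b) `^ p != 0 by rewrite gt_eqF// powR_gt0.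
rewrite mulrCA mulfV// mulr1 in H.
by apply: (le_trans H); rewrite le_eqVlt; apply/orP; left; apply/eqP; ring.
Qed.

Lemma powRD_convE (p a b : R) : 0 < a -> 0 < b ->
  (a + b) `^ p * (a / (a + b) / a `^ p) * a `^ p +
  (a + b) `^ p * (b / (a + b) / b `^ p) * b `^ p = (a + b) `^ p.
Proof.
move=> a0 b0; have ab0 := addr_gt0 a0 b0.
move: (powR_gt0 p a0) (powR_gt0 p b0) (powR_gt0 p ab0).
move: (a `^ p) (b `^ p) ((a + b) `^ p) => A B C A0 B0 C0.
by field; rewrite !gt_eqF.
Qed.

End real_facts.

Section lpZ.
Context (R : realType) (k : scalars) (p : R).

Definition lpZ_pred : {pred int -> scalar R k} :=
  fun x => summable [set: int] (fun n => (modulus (x n) `^ p)%:E).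

(* l^p(Z); the proof p1 is a parameter of the type so that the normed space
   structure can be attached to it. *)
Record lpZ (p1 : 1 <= p) := LpZ {
  lpZ_val :> int -> scalar R k ;
  lpZ_valP : lpZ_val \in lpZ_pred }.

End lpZ.
Arguments lpZ {R} k {p} p1.

Section lpZ_normed.
Context (R : realType) (k : scalars) (p : R) (p1 : 1 <= p).
Local Notation K := (scalar R k).
Local Notation X := (lpZ k p1).

HB.instance Definition _ := [isSub for @lpZ_val R k p p1].
HB.instance Definition _ := [Choice of X by <:].

Definition lpZ_energy (x : int -> K) : \bar R :=
  (\esum_(n in [set: int]) (modulus (x n) `^ p)%:E)%E.

Let p_gt0 : 0 < p. Proof. exact: lt_le_trans p1. Qed.

Lemma lpZ_predE x : (x \in @lpZ_pred R k p) = (lpZ_energy x < +oo)%E.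
Proof.
rewrite unfold_in /lpZ_pred /summable /lpZ_energy; congr (_ < _)%E.
by apply: eq_esum => n _; rewrite gee0_abs// lee_fin powR_ge0.
Qed.

Lemma lpZ_energy_ge0 x : (0 <= lpZ_energy x)%E.
Proof. by apply: esum_ge0 => n _; rewrite lee_fin powR_ge0. Qed.

Lemma lpZ_energyZ c x :
  (lpZ_energy (c *: x)%R <= (modulus c `^ p)%:E * lpZ_energy x)%E.
Proof.
apply: (@le_trans _ _
  (\esum_(n in [set: int]) (modulus c `^ p * modulus (x n) `^ p)%:E)%E).
  by apply: le_esum => n _; rewrite lee_fin modulusM powRM ?modulus_ge0.
by apply: esumZl => [|n]; rewrite powR_ge0.
Qed.

Lemma lpZ_energyD (a b : R) x y : 0 < a -> 0 < b ->
  (lpZ_energy (x + y)%R <=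
    ((a + b) `^ p * (a / (a + b) / a `^ p))%:E * lpZ_energy x +
    ((a + b) `^ p * (b / (a + b) / b `^ p))%:E * lpZ_energy y)%E.
Proof.
move=> a0 b0; set c := (X in (_ <= X%:E * _ + _)%E).
set d := (X in (_ <= _ + X%:E * _)%E).
have c0 : 0 <= c by rewrite mulr_ge0 ?powR_ge0// !divr_ge0 ?powR_ge0// ?addr_ge0 ?ltW.
have d0 : 0 <= d by rewrite mulr_ge0 ?powR_ge0// !divr_ge0 ?powR_ge0// ?addr_ge0 ?ltW.
apply: (@le_trans _ _ (\esum_(n in [set: int])
    ((c * modulus (x n) `^ p)%:E + (d * modulus (y n) `^ p)%:E))%E).
  apply: le_esum => n _; rewrite -EFinD lee_fin.
  apply: le_trans (powRD_conv p1 a0 b0 (modulus_ge0 _) (modulus_ge0 _)).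
  rewrite ge0_ler_powR ?nnegrE ?modulus_ge0 ?addr_ge0 ?modulus_ge0 ?(ltW p_gt0)//.
  exact: ler_modulusD.
rewrite (esumD (a := fun n => (c * modulus (x n) `^ p)%:E)
  (b := fun n => (d * modulus (y n) `^ p)%:E)); last 2 first.
- by move=> n _; rewrite lee_fin mulr_ge0 ?powR_ge0.
- by move=> n _; rewrite lee_fin mulr_ge0 ?powR_ge0.
by apply: leeD; apply: esumZl => // n; rewrite powR_ge0.
Qed.

Lemma lpZ_submod_closed : submod_closed (@lpZ_pred R k p).
Proof.
split.
  rewrite lpZ_predE /lpZ_energy esum1 ?ltry// => n _.
  by rewrite modulus0 powR0// gt_eqF.
move=> c x y; rewrite !lpZ_predE => x_fin y_fin.
have fin u : (lpZ_energy u < +oo)%E -> lpZ_energy u \is a fin_num.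
  by rewrite ge0_fin_numE// lpZ_energy_ge0.
apply: le_lt_trans (lpZ_energyD _ _ ltr01 ltr01) _.
have cx_fin : (lpZ_energy (c *: x)%R < +oo)%E.
  apply: le_lt_trans (lpZ_energyZ _ _) _.
  by rewrite -(fineK (fin _ x_fin)) -EFinM ltry.
by rewrite -(fineK (fin _ cx_fin)) -(fineK (fin _ y_fin)) -!EFinM -EFinD ltry.
Qed.

HB.instance Definition _ :=
  GRing.isSubmodClosed.Build _ _ (@lpZ_pred R k p) lpZ_submod_closed.
HB.instance Definition _ := [SubChoice_isSubLmodule of X by <:].

Definition lpZ_norm (x : X) : R :=
  fine (lpZ_energy x) `^ p^-1.

Lemma lpZ_normE (x : X) : ((lpZ_norm x `^ p)%:E = lpZ_energy x)%E.
Proof.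
have x_fin : lpZ_energy x \is a fin_num.
  by rewrite ge0_fin_numE ?lpZ_energy_ge0// -lpZ_predE; exact: lpZ_valP.
rewrite /lpZ_norm -powRrM mulVf ?gt_eqF// powRr1 ?fineK//.
exact: fine_ge0 (lpZ_energy_ge0 x).
Qed.

Lemma lpZ_norm_ge0 x : 0 <= lpZ_norm x.
Proof. exact: powR_ge0. Qed.

Lemma lpZ_norm_le (x : X) (c : R) : 0 <= c -> (lpZ_energy x <= (c `^ p)%:E)%E ->
  lpZ_norm x <= c.
Proof.
move=> c0; rewrite -lpZ_normE lee_fin => xc.
rewrite -[leLHS]powRr1 ?lpZ_norm_ge0// -[leRHS]powRr1//.
rewrite -[1](@mulfV _ p) ?gt_eqF// !powRrM.
by rewrite ge0_ler_powR ?nnegrE ?powR_ge0// invr_ge0 ltW.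
Qed.

Lemma modulus_le_lpZ_norm (x : X) n : modulus (x n) <= lpZ_norm x.
Proof.
suff : modulus (x n) `^ p <= lpZ_norm x `^ p.
  rewrite -[X in _ -> X <= _]powRr1 ?modulus_ge0//.
  rewrite -[X in _ -> _ <= X]powRr1 ?lpZ_norm_ge0//.
  rewrite -[1](@mulfV _ p) ?gt_eqF// !powRrM => le_p.
  by rewrite ge0_ler_powR ?nnegrE ?powR_ge0// invr_ge0 ltW.
rewrite -lee_fin lpZ_normE esum_ge//; exists [set n] => //.
by rewrite fsbig_set1.
Qed.

Lemma lpZ_norm_eq0 (x : X) : lpZ_norm x = 0 -> x = 0.
Proof.
move=> x0; apply/val_inj/funext => n /=; apply: modulus_eq0.
by apply/eqP; rewrite eq_le modulus_ge0 -x0 modulus_le_lpZ_norm.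
Qed.

Lemma ler_lpZ_normD (x y : X) : lpZ_norm (x + y) <= lpZ_norm x + lpZ_norm y.
Proof.
have [x0|x0] := eqVneq (lpZ_norm x) 0.
  by rewrite (lpZ_norm_eq0 x0) add0r lerDr lpZ_norm_ge0.
have [y0|y0] := eqVneq (lpZ_norm y) 0.
  by rewrite (lpZ_norm_eq0 y0) addr0 lerDl lpZ_norm_ge0.
have {}x0 : 0 < lpZ_norm x by rewrite lt_neqAle eq_sym x0 lpZ_norm_ge0.
have {}y0 : 0 < lpZ_norm y by rewrite lt_neqAle eq_sym y0 lpZ_norm_ge0.
apply: lpZ_norm_le; first exact: addr_ge0 (ltW x0) (ltW y0).
apply: le_trans (lpZ_energyD (lpZ_val x) (lpZ_val y) x0 y0) _.
rewrite -!lpZ_normE.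
move: (lpZ_norm x) (lpZ_norm y) x0 y0 => a b a0 b0.
rewrite -!EFinM -EFinD lee_fin powRD_convE//.
Qed.

Lemma lpZ_normZ_le (c : K) (x : X) :
  lpZ_norm (c *: x) <= modulus c * lpZ_norm x.
Proof.
apply: lpZ_norm_le; first by rewrite mulr_ge0 ?modulus_ge0 ?lpZ_norm_ge0.
apply: le_trans (lpZ_energyZ c (lpZ_val x)) _.
by rewrite -lpZ_normE -EFinM powRM ?modulus_ge0 ?lpZ_norm_ge0.
Qed.

Lemma lpZ_normZ (c : K) (x : X) : lpZ_norm (c *: x) = modulus c * lpZ_norm x.
Proof.
apply/eqP; rewrite eq_le lpZ_normZ_le/=.
have [->|c0] := eqVneq c 0; first by rewrite modulus0 mul0r lpZ_norm_ge0.
have mc0 : 0 < modulus c.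
  rewrite lt_neqAle modulus_ge0 andbT eq_sym.
  by apply: contra c0 => /eqP/modulus_eq0/eqP.
have := lpZ_normZ_le c^-1 (c *: x); rewrite scalerA mulVf// scale1r => H.
have := ler_wpM2l (modulus_ge0 c) H; rewrite mulrA -modulusM mulfV//.
have -> : modulus (1 : K) = 1 by rewrite -of_real1 modulus_of_real normr1.
by rewrite mul1r.
Qed.

Lemma ler_lpZ_normrD (x y : X) : of_real k (lpZ_norm (x + y)) <=
  of_real k (lpZ_norm x) + of_real k (lpZ_norm y).
Proof. by rewrite -of_realD ler_of_real ler_lpZ_normD. Qed.

Lemma lpZ_normrZ (c : K) (x : X) :
  of_real k (lpZ_norm (c *: x)) = `|c| * of_real k (lpZ_norm x).
Proof. by rewrite lpZ_normZ of_realM of_real_modulus. Qed.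

Lemma lpZ_normr_eq0 (x : X) : of_real k (lpZ_norm x) = 0 -> x = 0.
Proof. by move=> x0; apply/lpZ_norm_eq0/(@of_real_inj R k); rewrite of_real0. Qed.

(* A normed module over K must have its norm in K, hence the cast. *)
HB.instance Definition _ := @Lmodule_isNormed.Build K X
  (fun x => of_real k (lpZ_norm x)) ler_lpZ_normrD lpZ_normrZ lpZ_normr_eq0.

Lemma lpZ_normrE (x : X) : `|x| = of_real k (lpZ_norm x).
Proof. by []. Qed.

End lpZ_normed.

Section basis.
Context (R : realType) (k : scalars) (p : R) (p1 : 1 <= p).

Definition lpZ_delta (m : int) : int -> scalar R k :=
  fun n => if n == m then 1 else 0.

Lemma lpZ_delta_mem m : lpZ_delta m \in @lpZ_pred R k p.
Proof.
rewrite lpZ_predE /lpZ_energy.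
rewrite (_ : esum _ _ = \esum_(n in [set m]) 1%:E); last first.
  rewrite [RHS]esum_mkcond; apply: eq_esum => n _.
  have -> : (n \in [set m]) = (n == m) by apply/idP/eqP; rewrite inE.
  rewrite /lpZ_delta; case: eqP => _.
    by rewrite -of_real1 modulus_of_real normr1 powR1.
  by rewrite modulus0 powR0// gt_eqF// (lt_le_trans ltr01 p1).
by rewrite esum_set1// ?ltry// lee_fin.
Qed.

Definition lpZ_basis (m : int) : lpZ k p1 := LpZ p1 (lpZ_delta_mem m).

End basis.
Arguments lpZ_basis {R} k {p} p1 m.

Section weighted_shift.
Context {R : realType} (k : scalars) {p : R} (p1 : 1 <= p) {w : int -> R}.
Hypotheses (w_gt0 : forall n, 0 < w n) (w_bnd : exists M, forall n, w n <= M).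
Local Notation X := (lpZ k p1).

Definition shift_fun (x : X) : int -> scalar R k :=
  fun n => of_real k (w (n + 1)) * x (n + 1).

Lemma shift_energy_le (M : R) (x : X) : (forall n, w n <= M) ->
  (lpZ_energy p (shift_fun x) <= ((M * lpZ_norm x) `^ p)%:E)%E.
Proof.
move=> wM; have M0 : 0 <= M by apply: le_trans (wM 0); exact: ltW.
rewrite powRM ?lpZ_norm_ge0// EFinM lpZ_normE.
rewrite /lpZ_energy [in leRHS](reindex_esum setT setT (fun n : int => n + 1)).
  apply: (@le_trans _ _ (\esum_(n in [set: int])
      (M `^ p * modulus (x (n + 1)) `^ p)%:E)%E).
    apply: le_esum => n _; rewrite lee_fin modulusM modulus_of_real.
    rewrite powRM ?modulus_ge0// ler_wpM2r ?powR_ge0//.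
    rewrite gtr0_norm// ge0_ler_powR ?nnegrE ?(ltW (w_gt0 _))//.
    exact: ltW (lt_le_trans ltr01 p1).
  by apply: esumZl => [|n]; rewrite powR_ge0.
split=> //; first by move=> m n _ _ /addIr.
by move=> n _; exists (n - 1) => //=; rewrite subrK.
Qed.

Lemma shift_mem x : shift_fun x \in @lpZ_pred R k p.
Proof.
case: w_bnd => M wM; rewrite lpZ_predE.
exact: le_lt_trans (shift_energy_le x wM) (ltry _).
Qed.

(* (B x)_n = w_(n+1) x_(n+1), the bounded linear operator determined by
   B e_n = w_n e_(n-1): see [weighted_shift_basis], the linear instance and
   [weighted_shift_continuous]. *)
Definition weighted_shift (x : X) : X := LpZ p1 (shift_mem x).

Lemma weighted_shift_basis n :
  weighted_shift (lpZ_basis k p1 n) = of_real k (w n) *: lpZ_basis k p1 (n - 1).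
Proof.
apply/val_inj/funext => m /=; rewrite /shift_fun /= /lpZ_delta.
rewrite -[RHS]/(of_real k (w n) * (if m == n - 1 then 1 else 0)) eq_sym.
rewrite -subr_eq eq_sym; case: eqP => [->|_]; last by rewrite !mulr0.
by rewrite subrK.
Qed.

Lemma weighted_shift_linear : linear weighted_shift.
Proof.
move=> c x y; apply/val_inj/funext => n /=; rewrite /shift_fun.
rewrite -[RHS]/(c * (of_real k (w (n + 1)) * x (n + 1)) +
  of_real k (w (n + 1)) * y (n + 1)).
rewrite -[X in _ * X]/(c * x (n + 1) + y (n + 1)).
by rewrite mulrDr mulrCA.
Qed.

HB.instance Definition _ :=
  GRing.isLinear.Build (scalar R k) X X _ weighted_shift weighted_shift_linear.

Lemma weighted_shift_continuous : continuous weighted_shift.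
Proof.
apply: bounded_linear_continuous; apply/linear_boundedP.
case: w_bnd => M wM.
have M0 : 0 <= M by apply: le_trans (wM 0); exact: ltW.
near=> r => x; apply: (@le_trans _ _ (of_real k M * `|x|)).
  rewrite !lpZ_normrE -of_realM ler_of_real lpZ_norm_le//.
    by rewrite mulr_ge0 ?lpZ_norm_ge0.
  exact: shift_energy_le.
rewrite ler_wpM2r//; near: r; apply: nbhs_pinfty_ge.
by rewrite realE -(of_real0 (k := k)) ler_of_real M0.
Unshelve. all: by end_near. Qed.

End weighted_shift.
Arguments weighted_shift {R} k {p} p1 {w} w_gt0 w_bnd x.

Section densities.
Context (R : realType).

(* #A(n), where A(n) = {a in A : a <= n} *)
Definition count_upto (A : set nat) (n : nat) : nat :=
  #|[pred a : 'I_n.+1 | (a : nat) \in A]|.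

Definition lower_density (A : set nat) : \bar R :=
  limn_einf (fun n => ((count_upto A n)%:R / n%:R)%:E).

Definition upper_density (A : set nat) : \bar R :=
  limn_esup (fun n => ((count_upto A n)%:R / n%:R)%:E).

End densities.

Section frequent_hypercyclicity.
Context (R : realType) (K : numFieldType) (X : normedModType K).

Definition visits (T : X -> X) (x : X) (U : set X) : set nat :=
  [set n | U (iter n T x)].

Definition frequently_hypercyclic (T : {linear X -> X}) : Prop :=
  exists x : X, forall U : set X, open U -> U !=set0 ->
    (0 < lower_density R (visits T x U))%E.

Definition U_frequently_hypercyclic (T : {linear X -> X}) : Prop :=
  exists x : X, forall U : set X, open U -> U !=set0 ->
    (0 < upper_density R (visits T x U))%E.

End frequent_hypercyclicity.
Arguments frequently_hypercyclic R {K X} T.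
Arguments U_frequently_hypercyclic R {K X} T.

(* Main.v *)
(* Let v t be the two-sided product of the weights, so that x |-> (v t * x t)_t
   conjugates the weighted shift to the plain shift, and let
   alpha t = v t `^ - p; condition (iii) says that alpha is summable over Z.

   If x visits the ball B(e_0, 1/2) at the times of a set A, then v m * x m is
   close to 1 for m in A, so reading B^n x at the coordinates m - n gives
   sum_(m in A) alpha (m - n) <= C for every n in A.  When A has positive upper
   density, the differences m - n that occur with positive frequency form a
   syndetic set; averaging over n bounds the sum of alpha over that set, and
   alpha t <= M^p * alpha (t + 1) fills the bounded gaps.

   Conversely, choose an unbounded weight g with sum_t g |t| * alpha t finite,
   and lay out finite patterns in blocks with generous spacing so that
   every pattern occurs with positive lower density and a symbol at distance d
   from the centre of a foreign block satisfies |.|^p <= g d.  Dividing the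
   resulting two-sided sequence by v gives a frequently hypercyclic vector. *)
Require Import Defs.
From mathcomp Require Import all_boot all_order all_algebra.
From mathcomp Require Import all_classical all_reals all_analysis.
From mathcomp Require Import complex.
From mathcomp Require Import zify ring lra.
Set Implicit Arguments.
Unset Strict Implicit.
Unset Printing Implicit Defensive.
Import Order.TTheory GRing.Theory Num.Theory.
Import numFieldNormedType.Exports.
Local Open Scope classical_set_scope.
Local Open Scope ring_scope.

(** * Frequent differences of a set of positive upper density *)

Section pair_count.
Variables (P : pred nat) (N : nat).

(** The autocorrelation at lag [d] of [P] cut off at [N]. *)
Definition pair_count (d : int) : nat :=
  (\sum_(m < N.+1 | P m) \sum_(n < N.+1 | P n) ((m%:Z - n%:Z)%R == d))%N.

Lemma pair_countN d : pair_count (- d) = pair_count d.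
Proof.
rewrite /pair_count exchange_big /=; apply: eq_bigr => m _.
by apply: eq_bigr => n _; rewrite -eqr_opp opprB opprK.
Qed.

Lemma sum_eq_ord (T : nat) (x : int) :
  (\sum_(t < T) (x == t%:Z) = ((0 <= x) && (x < T%:Z))%R :> nat)%N.
Proof.
have [/andP[x0 xT]|xT] := boolP (_ && _).
  have xn : (absz x < T)%N by lia.
  rewrite (bigD1 (Ordinal xn)) //= big1 ?addn0; first by rewrite gez0_abs ?eqxx.
  move=> t /eqP tx; apply/eqP; rewrite eqb0; apply/eqP => xt.
  by apply: tx; apply/val_inj; rewrite /= xt.
rewrite big1 // => t _; apply/eqP; rewrite eqb0; apply: contra xT => /eqP ->.
by rewrite ltz_nat ltn_ord.
Qed.

Lemma pair_count0_le : (pair_count 0 <= \sum_(m < N.+1 | P m) 1)%N.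
Proof.
apply: leq_sum => m _; rewrite big_mkcond /=.
apply: (@leq_trans (\sum_(n < N.+1) (m%:Z == n%:Z))); last first.
  by rewrite sum_eq_ord; case: (_ && _).
by apply: leq_sum => n _; rewrite subr_eq0; case: (P n).
Qed.

(* The function f counts, for each t, the translates of P below N that contain
   t; the bound is the sum over t of 2 f t <= (f t) ^ 2 + 1. *)
Lemma translates_overlap (s : seq int) (L : nat) :
  {in s, forall i, `|i| <= L%:Z} ->
  (2 * (size s * \sum_(m < N.+1 | P m) 1) <=
   \sum_(i <- s) \sum_(j <- s) pair_count (j - i) + (N + L.*2).+1)%N.
Proof.
move=> sL; set T := (N + L.*2).+1.
pose e (t : 'I_T) (i : int) (m : 'I_N.+1) := m%:Z + i + L%:Z == t%:Z.
pose f (t : 'I_T) := (\sum_(i <- s) \sum_(m < N.+1 | P m) e t i m)%N.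
have sum_f : (\sum_(t < T) f t = size s * \sum_(m < N.+1 | P m) 1)%N.
  rewrite exchange_big /= -sum1_size big_distrl /= [LHS]big_seq [RHS]big_seq.
  apply: eq_bigr => i /sL iL; rewrite mul1n exchange_big /=.
  apply: eq_bigr => m _; rewrite sum_eq_ord.
  by rewrite (_ : _ && _ = true) // /T; have := ltn_ord m; lia.
have sum_f2 : (\sum_(t < T) f t * f t <=
    \sum_(i <- s) \sum_(j <- s) pair_count (j - i))%N.
  have -> : (\sum_(t < T) f t * f t = \sum_(i <- s) \sum_(j <- s)
      \sum_(m < N.+1 | P m) \sum_(n < N.+1 | P n) \sum_(t < T)
        e t i m * e t j n)%N.
    rewrite (eq_bigr (fun t => \sum_(i <- s) \sum_(j <- s)
      \sum_(m < N.+1 | P m) \sum_(n < N.+1 | P n) e t i m * e t j n)%N).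
      rewrite exchange_big; apply: eq_bigr => i _ /=.
      rewrite exchange_big; apply: eq_bigr => j _ /=.
      rewrite exchange_big; apply: eq_bigr => m _ /=.
      by rewrite exchange_big.
    move=> t _; rewrite /f big_distrl; apply: eq_bigr => i _ /=.
    rewrite big_distrr; apply: eq_bigr => j _ /=.
    rewrite big_distrl; apply: eq_bigr => m _ /=.
    by rewrite big_distrr.
  apply: leq_sum => i _; apply: leq_sum => j _.
  apply: leq_sum => m _; apply: leq_sum => n _.
  (* Each of the two equations fixes [t], so they share at most one solution, and none unless
     [m - n = j - i]. *)
  have [/eqP mn|mn] := boolP (m%:Z - n%:Z == j - i).
    apply: (@leq_trans (\sum_(t < T) e t i m)).
      by apply: leq_sum => t _; case: (e t i m); case: (e t j n).
    by rewrite sum_eq_ord; case: (_ && _).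
  rewrite big1 // => t _; rewrite /e.
  by case: eqP => //= ?; case: eqP => //= ?; lia.
rewrite -sum_f big_distrr /=.
apply: leq_trans (leq_add sum_f2 (leqnn _)).
rewrite -[X in (_ <= _ + X)%N]card_ord -sum1_card -big_split /=.
by apply: leq_sum => t _; nia.
Qed.

End pair_count.

Section density.
Context (R : realType).
Implicit Types A : set nat.

Lemma count_uptoE A N :
  count_upto A N = (\sum_(m < N.+1 | (m : nat) \in A) 1)%N.
Proof. by rewrite sum1_card. Qed.

Lemma upper_density_gt0 A : (0 < upper_density R A)%E ->
  exists2 delta : R, 0 < delta & forall N0 : nat,
    exists2 N, (N0 <= N)%N & delta * N%:R <= (count_upto A N)%:R.
Proof.
move=> A0; have [delta d0 dA] : exists2 delta : R,
    0 < delta & (delta%:E < upper_density R A)%E.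
  case: (upper_density R A) A0 => [r| |] //=.
    rewrite lte_fin => r0; exists (r / 2); first by rewrite divr_gt0.
    by rewrite lte_fin ltr_pdivrMr // ltr_pMr // ltr1n.
  by move=> _; exists 1; rewrite ?ltry.
exists delta => // N0.
(* Starting the tail at [N0.+1] makes [N] positive, so the quotient can be cleared. *)
have : (delta%:E < ereal_sup [set ((count_upto A n)%:R / n%:R)%:E | n in
    [set n | (N0.+1 <= n)%N]])%E.
  apply: lt_le_trans dA _; apply: ereal_inf_lbound.
  by exists [set n | (N0.+1 <= n)%N] => //; exists N0.+1.
move=> /ereal_sup_gt [_ [N /= N0N <-]]; rewrite lte_fin => dN.
exists N; first exact: ltnW.
by rewrite -ler_pdivlMr ?ltr0n ?(leq_ltn_trans _ N0N) // ltW.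
Qed.

Lemma lower_density_gt0 A (delta : R) (N0 : nat) : 0 < delta ->
    (forall N, (N0 <= N)%N -> delta * N%:R <= (count_upto A N)%:R) ->
  (0 < lower_density R A)%E.
Proof.
move=> d0 dA; apply: (@lt_le_trans _ _ delta%:E); first by rewrite lte_fin.
rewrite /lower_density limn_einf_lim; apply: lime_ge.
  exact: is_cvg_einfs.
exists N0.+1 => // n /= N0n; apply: le_ereal_inf_tmp => /= _ [m /= nm <-].
have N0m := leq_trans N0n nm.
by rewrite lee_fin ler_pdivlMr ?dA ?(ltnW N0m) // ltr0n (leq_ltn_trans _ N0m).
Qed.

(* The greedy argument takes place inside an ultrafilter U, which turns the
   sets D_N = {d | eta N <= r_N(d)} into the single set D of the differences
   that lie in D_N for U-almost all N. *)
Lemma frequent_differences_syndetic A : (0 < upper_density R A)%E ->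
  exists2 eta : R, 0 < eta & exists s : seq nat, forall S : seq int,
    exists2 N, (0 < N)%N & forall d, d \in S -> exists2 i, i \in s &
      eta * N%:R <= (pair_count (fun m => m \in A) N (d + i%:Z))%:R.
Proof.
move=> /upper_density_gt0 [delta d0 dA].
pose F : set_system nat :=
  within [set N | delta * N%:R <= (count_upto A N)%:R] \oo.
have FF : ProperFilter F.
  apply: Build_ProperFilter_ex => B [N0 _ N0B].
  by have [N N0N dN] := dA N0; exists N; apply: N0B.
have [U [UU FU]] := ultraFilterLemma FF.
have PU : ProperFilter U := ultra_proper.
have Uinf N0 : U [set N | (N0 <= N)%N].
  by apply: FU; exists N0 => // N N0N _.
have Udense : U [set N | delta * N%:R <= (count_upto A N)%:R].
  by apply: FU; exists 0%N.
(* With [r * delta > 3] and [eta = r^-2], a sparse family of size [r] would give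
   [2 r c <= r c + N + 2 N], where [c] counts [A] up to [N]; but [r c >= r delta N > 3 N]. *)
pose r := Num.bound (3 / delta).
have r_gt : 3 < r%:R * delta.
  by rewrite -ltr_pdivrMr // archi_boundP // divr_ge0 // ltW.
have r0 : (0 : R) < r%:R.
  by rewrite -(pmulr_lgt0 _ d0) (lt_trans _ r_gt).
pose eta : R := r%:R^-2.
have eta0 : 0 < eta by rewrite invr_gt0 exprn_gt0.
pose pc N d : R := (pair_count (fun m => m \in A) N d)%:R.
pose D d := U [set N | eta * N%:R <= pc N d].
pose sparse := pairwise (fun i j : int => `[< ~ D (j - i) >]).
(* Each diagonal pair contributes at most the count of [A]. Every other pair fails [D], and as [U]
   is an ultrafilter its count is below [eta * N] for [U]-almost all [N]. *)
have sparse_lt s : sparse s -> U [set N |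
    \sum_(i <- s) \sum_(j <- s) pc N (j - i) <=
    (size s)%:R * (count_upto A N)%:R + (size s)%:R ^+ 2 * (eta * N%:R)].
  elim: s => [|i s IHs] /=.
    by move=> _; apply: filterS filterT => N _ /=; rewrite big_nil; lra.
  rewrite /sparse /= => /andP[si /IHs {IHs}].
  have : U [set N | forall j, j \in s -> pc N (j - i) <= eta * N%:R].
    elim: s si => [|j s IHs] /=; first by move=> _; apply: filterS filterT.
    move=> /andP[/asboolP Dj /IHs].
    have [//|{}Dj] := in_ultra_setVsetC [set N | eta * N%:R <= pc N (j - i)] UU.
    apply: filterS2 Dj => N /= /negP; rewrite -ltNge => /ltW Nj Ns j'.
    by rewrite inE => /predU1P[->|/Ns].
  apply: filterS2 => N /= Ni Ns; rewrite big_cons [X in X + _]big_cons /=.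
  under [X in _ + X <= _]eq_bigr => j _ do rewrite big_cons.
  rewrite [X in _ + X <= _]big_split /=.
  have -> : \sum_(j <- s) pc N (i - j) = \sum_(j <- s) pc N (j - i).
    by apply: eq_bigr => j _; rewrite /pc -pair_countN opprB.
  have : \sum_(j <- s) pc N (j - i) <= (size s)%:R * (eta * N%:R).
    rewrite big_seq (le_trans (ler_sum _ Ni)) // -big_seq.
    by rewrite big_const_seq count_predT iter_addr addr0 mulr_natl.
  have : pc N (i - i) <= (count_upto A N)%:R.
    by rewrite subrr ler_nat count_uptoE pair_count0_le.
  have : 0 <= eta * N%:R by rewrite mulr_ge0 // ltW.
  move: Ns; rewrite -natr1; set C := _%:R : R; set t := eta * _.
  set X := \sum_(j <- s) pc N (j - i); set Y := \sum_(j <- s) _.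
  set Z := pc _ _; set m := (size s)%:R : R.
  by move=> *; nra.
have sparse_size s : sparse s -> size s <> r.
  move=> /sparse_lt Us sr.
  pose L := (\sum_(i <- s) absz i)%N.
  have sL : {in s, forall i, `|i| <= L%:Z}.
    move=> i si; rewrite -abszE lez_nat /L (perm_big _ (perm_to_rem si)).
    rewrite big_cons; exact: leq_addr.
  have [N [[/= Ns Nd] NL]] :=
    filter_ex (filterI (filterI Us Udense) (Uinf (3 * L).+2)).
  have := translates_overlap (fun m => m \in A) N sL; rewrite -(ler_nat R).
  rewrite natrD 2!natrM -count_uptoE sr natr_sum.
  under eq_bigr do rewrite natr_sum.
  move: Ns; rewrite sr; set X := \sum_(i <- s) _; set c := (count_upto _ _)%:R.
  move=> Xle; rewrite mulrA.
  have eta_r : r%:R ^+ 2 * (eta * N%:R) = N%:R.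
    by rewrite mulrA /eta mulfV ?mul1r // expf_neq0 // gt_eqF.
  have N3 : (N + L.*2).+1%:R <= 2 * N%:R :> R.
    rewrite -natrM ler_nat; move: NL => /=; lia.
  have rc : r%:R * delta * N%:R <= r%:R * c :> R by rewrite -mulrA ler_pM2l.
  have N0 : 0 < N%:R :> R by rewrite ltr0n; move: NL => /=; lia.
  nra.
(* Otherwise every sparse sequence could be extended, and one of size [r] would arise. *)
have [s s_max] : exists s : seq int, forall d, exists2 i, i \in s & D (d - i).
  apply: contrapT => no_s.
  suff H n : exists2 s, sparse s & size s = n.
    by have [s /sparse_size + sr] := H r; rewrite sr.
  elim: n => [|n [s ss sn]]; first by exists [::].
  have [d ds] : exists d, forall i, i \in s -> ~ D (d - i).
    apply: contrapT => no_d; apply: no_s; exists s => d.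
    apply: contrapT => no_i; apply: no_d; exists d => i si Di.
    by apply: no_i; exists i.
  exists (d :: s); last by rewrite /= sn.
  rewrite /sparse /=; apply/andP; split => //.
  apply/allP => i si; apply/asboolP => Di; apply: (ds i si).
  by apply: filterS Di => N; rewrite /= /pc -[i - d]opprB pair_countN.
(* Replacing [d] by [d + J] turns the shifts [- i] into natural numbers [J - i]. *)
exists eta => //; pose J := (\sum_(i <- s) absz i)%N.
have sJ : {in s, forall i, i <= J%:Z}.
  move=> i si; rewrite (le_trans (ler_norm _)) // -abszE lez_nat /J.
  by rewrite (perm_big _ (perm_to_rem si)) big_cons leq_addr.
exists [seq absz (J%:Z - i) | i <- s] => S.
suff : U [set N | forall d, d \in S ->
    exists2 i, i \in [seq absz (J%:Z - i) | i <- s] &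
      eta * N%:R <= pc N (d + i%:Z)].
  by move=> US; have [N [NS N0]] := filter_ex (filterI US (Uinf 1%N)); exists N.
elim: S => [|d S IHS]; first by apply: filterS filterT.
have [i si Di] := s_max (d + J%:Z).
apply: filterS2 IHS Di => N NS Ni d'; rewrite inE => /predU1P[->|/NS//].
exists (absz (J%:Z - i)); first by apply/mapP; exists i.
by rewrite gez0_abs ?subr_ge0 ?sJ // addrA.
Qed.

End density.

(** * Bounding a two-sided sum through frequent differences *)

Section integer_sums.
Context (R : realType).
Implicit Types alpha : int -> R.

(** As [Negz n] is [- (n + 1)], this is the partial sum over [-K <= t < K]. *)
Definition int_sum alpha (K : nat) : R :=
  \sum_(n < K) (alpha (Posz n) + alpha (Negz n)).

Lemma le_int_sum alpha (C : R) :
    (forall S : seq int, uniq S -> \sum_(d <- S) alpha d <= C) ->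
  forall K, int_sum alpha K <= C.
Proof.
move=> alphaC K; rewrite /int_sum big_split /=.
rewrite -[X in X + _](big_mkord xpredT (fun n => alpha (Posz n))).
rewrite -[X in _ + X](big_mkord xpredT (fun n => alpha (Negz n))).
rewrite -(big_map Posz xpredT alpha) -(big_map Negz xpredT alpha) -big_cat /=.
apply: alphaC; rewrite cat_uniq !map_inj_uniq ?iota_uniq //=.
- by rewrite andbT; apply/hasPn => _ /mapP[n _ ->]; apply/negP => /mapP[].
- by move=> m n [].
- by move=> m n [].
Qed.

Lemma ler_iter_growth alpha (M : R) : 0 <= M ->
    (forall t, alpha t <= M * alpha (t + 1)) ->
  forall t (i : nat), alpha t <= M ^+ i * alpha (t + i%:Z).
Proof.
move=> M0 alphaM t; elim=> [|i IHi]; first by rewrite addr0 expr0 mul1r.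
apply: le_trans IHi _; rewrite exprSr -mulrA ler_wpM2l ?exprn_ge0 //.
by rewrite intS addrA (addrAC t).
Qed.

(** Pairs are grouped by their difference; [S] has no repetitions, so each pair is counted at most
    once. *)
Lemma sum_pair_count_le (A : set nat) (N : nat) alpha (S : seq int) :
    (forall t, 0 <= alpha t) -> uniq S ->
  \sum_(d <- S) alpha d * (pair_count (fun m => m \in A) N d)%:R <=
  \sum_(n < N.+1 | (n : nat) \in A) \sum_(m < N.+1 | (m : nat) \in A)
    alpha (m%:Z - n%:Z).
Proof.
move=> alpha0 uS; rewrite exchange_big /=.
have -> : \sum_(d <- S) alpha d * (pair_count (fun m => m \in A) N d)%:R =
    \sum_(m < N.+1 | (m : nat) \in A) \sum_(n < N.+1 | (n : nat) \in A)
      \sum_(d <- S) alpha d * (m%:Z - n%:Z == d)%:R.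
  rewrite (eq_bigr (fun d => \sum_(m < N.+1 | (m : nat) \in A)
    \sum_(n < N.+1 | (n : nat) \in A) alpha d * (m%:Z - n%:Z == d)%:R)).
    by rewrite exchange_big; apply: eq_bigr => m _; rewrite exchange_big.
  move=> d _; rewrite /pair_count natr_sum big_distrr; apply: eq_bigr => m _ /=.
  by rewrite natr_sum big_distrr.
apply: ler_sum => m _; apply: ler_sum => n _.
rewrite (eq_bigr (fun d => alpha (m%:Z - n%:Z) * (d == m%:Z - n%:Z)%:R)).
  rewrite -big_distrr -natr_sum /= -[leRHS]mulr1 ler_wpM2l //.
  rewrite (_ : (\sum_(d <- S) _)%N = count_mem (m%:Z - n%:Z) S).
    by rewrite count_uniq_mem // lern1 leq_b1.
  by rewrite -sum1_count [RHS]big_mkcond.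
by move=> d _; rewrite eq_sym; case: eqP => [->|]; rewrite ?mulr0.
Qed.

(** Each [d] in [S] reaches a frequent difference [d + i] with [i] in a finite list, at the cost of
    a factor [M ^+ i]. For each [i], the sum weighted by pair counts is at most
    [C * (N + 1) <= 2 C N]; dividing by [eta * N] leaves a bound independent of [S]. *)
Lemma sum_le_of_differences (A : set nat) alpha (M C : R) :
    (0 < upper_density R A)%E -> 0 <= M -> 0 <= C ->
    (forall t, 0 <= alpha t) -> (forall t, alpha t <= M * alpha (t + 1)) ->
    (forall n N, n \in A ->
      \sum_(m < N.+1 | (m : nat) \in A) alpha (m%:Z - n%:Z) <= C) ->
  exists C', forall S : seq int, uniq S -> \sum_(d <- S) alpha d <= C'.
Proof.
move=> A0 M0 C0 alpha0 alphaM alphaC.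
have [eta eta0 [s sP]] := frequent_differences_syndetic A0.
exists (\sum_(i <- s) M ^+ i * (C * 2 / eta)) => S uS.
have [N N0 NS] := sP S.
pose r d : R := (pair_count (fun m => m \in A) N d)%:R.
have etaN : 0 < eta * N%:R by rewrite mulr_gt0 // ltr0n.
rewrite -(ler_pM2r etaN) mulr_suml mulr_suml.
apply: (@le_trans _ _ (\sum_(d <- S) \sum_(i <- s)
    M ^+ i * (alpha (d + i%:Z) * r (d + i%:Z)))).
  rewrite big_seq [leRHS]big_seq; apply: ler_sum => d /NS[i si r_ge].
  rewrite (perm_big _ (perm_to_rem si)) big_cons /=.
  rewrite -[leLHS]addr0 lerD ?sumr_ge0 //.
    rewrite mulrA; apply: ler_pM => //; first exact: ltW.
    exact: ler_iter_growth.
  by move=> j _; rewrite !mulr_ge0 ?exprn_ge0.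
rewrite exchange_big /=; apply: ler_sum => i _.
rewrite -mulr_sumr -[leRHS]mulrA ler_wpM2l ?exprn_ge0 //.
rewrite -(big_map (fun d => d + i%:Z) xpredT (fun d => alpha d * r d)).
apply: le_trans (sum_pair_count_le A N alpha0 _) _.
  by rewrite map_inj_uniq // => x y /addIr.
apply: (@le_trans _ _ (C * N.+1%:R)).
  apply: (@le_trans _ _ (\sum_(n < N.+1 | (n : nat) \in A) C)).
    by apply: ler_sum => n nA; exact: alphaC.
  rewrite big_mkcond /= mulr_natr -[X in _ *+ X]card_ord -sumr_const.
  by apply: ler_sum => n _; case: ifP.
have -> : C * 2 / eta * (eta * N%:R) = C * (2 * N%:R).
  by field; rewrite gt_eqF.
rewrite ler_wpM2l // -natrM ler_nat; lia.
Qed.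

End integer_sums.

(** * Summable families on the integers and unbounded weights *)

Section summable_int.
Context (R : realType).
Implicit Types (F : int -> R) (S : seq int).

(** Constant on the pairs [t], [- 1 - t] that [int_sum] adds together. *)
Definition int_index (t : int) : nat :=
  match t with Posz n => n | Negz n => n end.

Lemma sum_le_int_sum F S (K : nat) : (forall t, 0 <= F t) -> uniq S ->
  (forall t, t \in S -> int_index t < K)%N -> \sum_(t <- S) F t <= int_sum F K.
Proof.
move=> F0 uS SK.
have sum_eq u : \sum_(t <- S) F u * (t == u)%:R <= F u.
  rewrite -big_distrr -natr_sum /= -[leRHS]mulr1 ler_wpM2l //.
  rewrite (_ : (\sum_(d <- S) _)%N = count_mem u S).
    by rewrite count_uniq_mem // lern1 leq_b1.
  by rewrite -sum1_count [RHS]big_mkcond.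
apply: (@le_trans _ _ (\sum_(n < K) \sum_(t <- S)
    (F (Posz n) * (t == Posz n)%:R + F (Negz n) * (t == Negz n)%:R))).
  rewrite exchange_big /= big_seq [leRHS]big_seq; apply: ler_sum => t /SK tK.
  rewrite (bigD1 (Ordinal tK)) //= -[leLHS]addr0 lerD ?sumr_ge0 //.
    by case: t tK => n /= _; rewrite eqxx mulr1 ?mulr0 ?addr0 ?add0r.
  by move=> n _; rewrite addr_ge0 ?mulr_ge0.
apply: ler_sum => n _; rewrite big_split /=; exact: lerD.
Qed.

Lemma esum_int_le F (C : R) : (forall t, 0 <= F t) ->
    (forall K, int_sum F K <= C) ->
  (\esum_(t in [set: int]) (F t)%:E <= C%:E)%E.
Proof.
move=> F0 FC; rewrite ge_ereal_sup => //= _ [X [finX _] <-].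
rewrite fsbig_finite //= sumEFin lee_fin.
pose K := (\sum_(t <- finmap.enum_fset (fset_set X)) int_index t)%N.
apply: (@le_trans _ _ (int_sum F K.+1)) => //.
apply: sum_le_int_sum => // [|t tX]; first exact: finmap.fset_uniq.
by rewrite ltnS /K (perm_big _ (perm_to_rem tX)) big_cons leq_addr.
Qed.

Lemma sum_le_esum F S : uniq S ->
  ((\sum_(t <- S) F t)%:E <= \esum_(t in [set: int]) (F t)%:E)%E.
Proof.
move=> uS; rewrite esum_ge //; exists [set` S] => //.
  by split=> //; exact: finite_seq.
by rewrite -fsbig_seq // sumEFin.
Qed.

Lemma nondecreasing_sup_gap (s : nat -> R) (C : R) :
    {homo s : m n / (m <= n)%N >-> m <= n} -> (forall n, s n <= C) ->
  exists2 L, (forall n, s n <= L) & forall e, 0 < e -> exists n, L - s n < e.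
Proof.
move=> s_homo sC; have cs : cvgn s.
  by apply: nondecreasing_is_cvgn => //; exists C => _ [n _ <-].
exists (limn s) => [|e e0]; first exact: nondecreasing_cvgn_le.
have /cvgrPdist_lt /(_ e e0) [n _ /(_ n (leqnn n))] := cs.
by move=> /(le_lt_trans (ler_norm _)) ?; exists n.
Qed.

Lemma nondecreasing_sum (a : nat -> R) : (forall n, 0 <= a n) ->
  {homo (fun K => \sum_(n < K) a n) : m n / (m <= n)%N >-> m <= n}.
Proof.
move=> a0 m n mn; rewrite -(subnKC mn) big_split_ord /= lerDl.
exact: sumr_ge0.
Qed.

(* With tau n the n-th remainder of the series, the weight is
   g = 1 / sqrt tau: then g n * a n <= 2 (sqrt (tau n) - sqrt (tau n.+1)). *)
Lemma unbounded_summable_weight (a : nat -> R) (C : R) :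
    (forall n, 0 < a n) -> (forall K, \sum_(n < K) a n <= C) ->
  exists g : nat -> R, [/\ forall n, 0 <= g n,
    {homo g : m n / (m <= n)%N >-> m <= n}, forall B, exists n, B <= g n &
    exists C', forall K, \sum_(n < K) g n * a n <= C'].
Proof.
move=> a0 aC; pose s K := \sum_(n < K) a n.
have s_homo : {homo s : m n / (m <= n)%N >-> m <= n}.
  by apply: nondecreasing_sum => n; exact: ltW.
have [L sL Ls] := nondecreasing_sup_gap s_homo aC.
pose tau n := L - s n.
have tauS n : tau n = tau n.+1 + a n by rewrite /tau /s big_ord_recr /=; ring.
have tau_ge0 n : 0 <= tau n by rewrite subr_ge0.
(* Since every term is positive, no remainder vanishes and its square root is invertible. *)
have tau0 n : 0 < tau n by rewrite tauS ltr_wpDl.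
have sq n : Num.sqrt (tau n) ^+ 2 = tau n by rewrite sqr_sqrtr.
have sqrt_gt0 n : 0 < Num.sqrt (tau n) by rewrite sqrtr_gt0.
exists (fun n => (Num.sqrt (tau n))^-1); split.
- by move=> n; rewrite invr_ge0 ltW.
- by move=> m n mn; rewrite lef_pV2 ?posrE // ler_wsqrtr // lerD2l lerN2 s_homo.
- move=> B; pose b := Num.max B 1.
  have b0 : 0 < b by rewrite lt_max ltr01 orbT.
  have [|n tn] := Ls (b^-1 ^+ 2); first by rewrite exprn_gt0 ?invr_gt0.
  exists n; apply: (@le_trans _ _ b); first by rewrite le_max lexx.
  rewrite -[leLHS]invrK lef_pV2 ?posrE ?invr_gt0 //.
  rewrite -[leRHS]ger0_norm ?invr_ge0 ?(ltW b0) // -sqrtr_sqr.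
  by rewrite ler_wsqrtr // ltW.
exists (2 * Num.sqrt (tau 0)) => K.
suff : \sum_(n < K) (Num.sqrt (tau n))^-1 * a n <=
    2 * (Num.sqrt (tau 0) - Num.sqrt (tau K)).
  by move=> /le_trans; apply; rewrite ler_wpM2l // lerBlDr lerDl ltW.
elim: K => [|K IHK]; first by rewrite big_ord0 subrr mulr0.
rewrite big_ord_recr /=; apply: le_trans (lerD IHK (lexx _)) _.
have -> : a K = Num.sqrt (tau K) ^+ 2 - Num.sqrt (tau K.+1) ^+ 2.
  by rewrite !sq [tau K]tauS addrC addKr.
have le_sqrt : Num.sqrt (tau K.+1) <= Num.sqrt (tau K).
  by rewrite ler_wsqrtr // [leRHS]tauS lerDl ltW.
move: (sqrt_gt0 K) (sqrt_gt0 K.+1) le_sqrt.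
set x := Num.sqrt (tau K); set y := Num.sqrt (tau K.+1); set z := Num.sqrt _.
move=> x0 y0 yx; rewrite addrC -lerBrDr.
have -> : 2 * (z - y) - 2 * (z - x) = x^-1 * (2 * x * (x - y)).
  by field; rewrite gt_eqF.
rewrite ler_wpM2l ?invr_ge0 ?(ltW x0) //; nra.
Qed.

Lemma int_sum_tail F (C e : R) : (forall t, 0 <= F t) ->
    (forall K, int_sum F K <= C) -> 0 < e ->
  exists T, forall K,
    int_sum (fun t => if (int_index t < T)%N then 0 else F t) K <= e.
Proof.
move=> F0 FC e0.
have F_homo : {homo int_sum F : m n / (m <= n)%N >-> m <= n}.
  apply: (nondecreasing_sum (a := fun n => F (Posz n) + F (Negz n))) => n.
  by rewrite addr_ge0.
have [L FL LF] := nondecreasing_sup_gap F_homo FC.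
have [T LT] := LF e e0; exists T => K; set F' := (fun t => _).
have F'0 t : 0 <= F' t by rewrite /F'; case: ifP.
have F'_homo : {homo int_sum F' : m n / (m <= n)%N >-> m <= n}.
  apply: (nondecreasing_sum (a := fun n => F' (Posz n) + F' (Negz n))) => n.
  by rewrite addr_ge0.
(* Up to [T + K], the truncated sum is exactly a difference of two partial sums of [F]. *)
apply: le_trans (F'_homo _ (T + K)%N (leq_addl _ _)) _.
suff : int_sum F' (T + K) = int_sum F (T + K) - int_sum F T.
  by move=> ->; rewrite (le_trans _ (ltW LT)) // lerD2r.
rewrite /int_sum !big_split_ord /= [X in X + _ = _]big1 => [|n _].
  rewrite add0r addrAC subrr add0r; apply: eq_bigr => n _.
  by rewrite /F' /= ltnNge leq_addr.
by rewrite /F' /= ltn_ord addr0.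
Qed.

End summable_int.

(** * Necessity of the summability condition *)

Lemma powRV (R : realType) (x p : R) : 0 <= x -> x^-1 `^ p = (x `^ p)^-1.
Proof. by move=> x0; rewrite -powR_inv1 // -powRrM mulN1r powRN. Qed.

Section weight_product.
Context (R : realType) (w : int -> R).
Hypothesis w_gt0 : forall n, 0 < w n.

(* The two-sided product v with v 0 = 1 and v (t + 1) = v t * w (t + 1): the
   map x |-> (v t * x t)_t conjugates the weighted shift to the unweighted
   one. *)
Definition weight_prod (t : int) : R :=
  match t with
  | Posz n => \prod_(1 <= i < n.+1) w i%:Z
  | Negz n => (\prod_(0 <= i < n.+1) w (- i%:Z))^-1
  end.

Lemma weight_prod0 : weight_prod 0 = 1.
Proof. by rewrite /= big_geq. Qed.

Lemma weight_prod_gt0 t : 0 < weight_prod t.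
Proof. by case: t => n; rewrite /= ?invr_gt0 prodr_gt0. Qed.

Lemma weight_prodD1 t : weight_prod (t + 1) = weight_prod t * w (t + 1).
Proof.
case: t => [n|[|n]].
- rewrite (_ : Posz n + 1 = Posz n.+1); last by lia.
  by rewrite /= big_nat_recr.
- by rewrite (_ : Negz 0 + 1 = 0) //= big_geq // big_nat1 oppr0 mulVf ?gt_eqF.
rewrite (_ : Negz n.+1 + 1 = Negz n); last by rewrite !NegzE; lia.
rewrite /= [in RHS]big_nat_recr //= NegzE invfM mulfVK //.
by rewrite gt_eqF.
Qed.

End weight_product.

Section weighted_shift_iterates.
Context (R : realType) (k : scalars) (p : R) (p1 : 1 <= p) (w : int -> R).
Hypotheses (w_gt0 : forall n, 0 < w n) (w_bnd : exists M, forall n, w n <= M).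
Local Notation K := (Defs.scalar R k).
Local Notation X := (lpZ k p1).
Local Notation B := (weighted_shift k p1 w_gt0 w_bnd).
Local Notation v := (weight_prod w).

(** The product of the weights from [t + 1] to [t + n] telescopes to a quotient of values of [v]. *)
Lemma iter_weighted_shift n (x : X) t :
  iter n B x t = of_real k (v (t + n%:Z) / v t) * x (t + n%:Z).
Proof.
have v0 s : v s != 0 by rewrite gt_eqF ?weight_prod_gt0.
elim: n t => [|n IHn] t; first by rewrite addr0 divff ?of_real1 ?mul1r.
rewrite iterS; have -> : t + n.+1%:Z = t + 1 + n%:Z by rewrite intS addrA.
rewrite -[LHS]/(of_real k (w (t + 1)) * iter n B x (t + 1)) IHn mulrA -of_realM.
congr (of_real k _ * _); rewrite weight_prodD1 //; field.
by rewrite v0 gt_eqF ?w_gt0.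
Qed.

Lemma ltr_of_real (x y : R) : (of_real k x < of_real k y) = (x < y).
Proof. by rewrite !lt_neqAle ler_of_real (inj_eq of_real_inj). Qed.

Lemma of_real_gt0 (x : R) : (0 < of_real k x) = (0 < x).
Proof. by rewrite -[X in X < _](@of_real0 R k) ltr_of_real. Qed.

Lemma ball_lpZ (x y : X) (r : R) :
  ball x (of_real k r) y <-> lpZ_norm (x - y) < r.
Proof. by rewrite -ltr_of_real -lpZ_normrE -ball_normE. Qed.

Lemma lpZ_val_sub (x y : X) t : (x - y) t = x t - y t.
Proof. by []. Qed.

Lemma sum_le_lpZ_norm (x : X) (S : seq int) : uniq S ->
  \sum_(t <- S) modulus (x t) `^ p <= lpZ_norm x `^ p.
Proof. by move=> uS; rewrite -lee_fin lpZ_normE; apply: sum_le_esum. Qed.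

Lemma lpZ_norm_basis m : lpZ_norm (lpZ_basis k p1 m) <= 1.
Proof.
apply: lpZ_norm_le => //; rewrite powR1 /lpZ_energy.
rewrite (_ : esum _ _ = \esum_(n in [set m]) 1%:E)%E; last first.
  rewrite [RHS]esum_mkcond; apply: eq_esum => n _.
  have -> : (n \in [set m]) = (n == m) by apply/idP/eqP; rewrite inE.
  rewrite /= /lpZ_delta; case: eqP => _.
    by rewrite -of_real1 modulus_of_real normr1 powR1.
  by rewrite modulus0 powR0 // gt_eqF // (lt_le_trans ltr01 p1).
by rewrite esum_set1 // lee_fin.
Qed.

Lemma modulus1 : modulus (1 : K) = 1 :> R.
Proof. by rewrite -of_real1 modulus_of_real normr1. Qed.

Lemma modulusN (z : K) : modulus (- z) = modulus z :> R.
Proof. by apply: (of_real_inj (k := k)); rewrite !of_real_modulus normrN. Qed.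

Lemma lpZ_normN (x : X) : lpZ_norm (- x) = lpZ_norm x.
Proof. by rewrite -scaleN1r lpZ_normZ modulusN modulus1 mul1r. Qed.

Local Notation alpha := (fun t => (v t `^ p)^-1).

(** For [m] in [A], coordinate 0 of [B^m x], namely [v m * x m], has modulus at least 1/2. Divided
    by [v (m - n)], it is coordinate [m - n] of [B^n x], whose norm is at most 2. One factor 2^p
    comes from the lower bound, the other from the norm. *)
Lemma sum_visits_le (x : X) (n N : nat) (A : set nat) :
    (forall m, m \in A ->
      lpZ_norm (lpZ_basis k p1 0 - iter m B x) < 1 / 2) -> n \in A ->
  \sum_(m < N.+1 | (m : nat) \in A) alpha (m%:Z - n%:Z) <= 2 `^ p * 2 `^ p.
Proof.
move=> Ax nA; have p0 : 0 < p := lt_le_trans ltr01 p1.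
have v0 s : 0 < v s by rewrite weight_prod_gt0.
have xm m : m \in A -> 1 <= 2 * (v m%:Z * modulus (x m%:Z)).
  move=> /Ax xm; have := modulus_le_lpZ_norm (lpZ_basis k p1 0 - iter m B x) 0.
  rewrite lpZ_val_sub iter_weighted_shift add0r weight_prod0 divr1.
  rewrite [X in modulus (X - _)]/= /lpZ_delta eqxx => /le_lt_trans /(_ xm) xm2.
  set z := of_real k _ * _ in xm2.
  have -> : v m%:Z * modulus (x m%:Z) = modulus z.
    by rewrite modulusM modulus_of_real gtr0_norm.
  have := ler_modulusD (1 - z) z; rewrite subrK modulus1; lra.
have norm2 : lpZ_norm (iter n B x) <= 2.
  have -> : iter n B x = lpZ_basis k p1 0 + - (lpZ_basis k p1 0 - iter n B x).
    by rewrite opprB addrC subrK.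
  apply: le_trans (ler_lpZ_normD _ _) _.
  rewrite lpZ_normN.
  by apply: le_trans (lerD (lpZ_norm_basis 0) (ltW (Ax n nA))) _; lra.
apply: (@le_trans _ _ (2 `^ p * lpZ_norm (iter n B x) `^ p)); last first.
  by rewrite ler_wpM2l ?powR_ge0 // ge0_ler_powR ?nnegrE ?lpZ_norm_ge0 // ltW.
pose S := [seq m%:Z - n%:Z | m <- iota 0 N.+1].
have uS : uniq S by rewrite map_inj_uniq ?iota_uniq // => a b /addIr[].
apply: le_trans _ (ler_wpM2l (powR_ge0 _ _) (sum_le_lpZ_norm _ uS)).
rewrite /S big_map -[iota _ _]/(index_iota 0 N.+1) big_mkord big_distrr /=.
rewrite big_mkcond /=; apply: ler_sum => m _; case: ifP => [mA|_]; last first.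
  by rewrite mulr_ge0 ?powR_ge0.
rewrite iter_weighted_shift subrK modulusM modulus_of_real.
rewrite ger0_norm ?divr_ge0 ?(ltW (v0 _)) //.
rewrite mulrAC -powRM ?divr_ge0 ?mulr_ge0 ?modulus_ge0 ?(ltW (v0 _)) //.
rewrite mulrA powRM ?invr_ge0 ?mulr_ge0 ?modulus_ge0 ?(ltW (v0 _)) //.
rewrite powRV ?(ltW (v0 _)) //.
rewrite ler_peMl ?invr_ge0 ?powR_ge0 //.
apply: (@le_trans _ _ (1 `^ p)); first by rewrite powR1.
by rewrite ge0_ler_powR ?nnegrE ?mulr_ge0 ?modulus_ge0 ?xm ?(ltW (v0 _)) // ltW.
Qed.

Lemma weight_prod_sum_le : U_frequently_hypercyclic R B ->
  exists C, forall N, int_sum alpha N <= C.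
Proof.
move=> [x xU]; have [M wM] := w_bnd.
have p0 : 0 < p := lt_le_trans ltr01 p1.
have v0 s : 0 < v s by rewrite weight_prod_gt0.
have M0 : 0 <= M by rewrite (le_trans _ (wM 0)) // ltW.
pose U := ball (lpZ_basis k p1 0) (of_real k (1 / 2 : R)).
have half0 : 0 < of_real k (1 / 2 : R).
  by rewrite of_real_gt0; lra.
have A0 : (0 < upper_density R (visits B x U))%E.
  apply: xU; first exact: ball_open.
  by exists (lpZ_basis k p1 0); exact: ballxx.
have alpha0 t : 0 <= alpha t by rewrite invr_ge0 powR_ge0.
have alphaM t : alpha t <= M `^ p * alpha (t + 1).
  rewrite weight_prodD1 // powRM ?(ltW (v0 _)) ?(ltW (w_gt0 _)) // invfM.
  rewrite mulrCA ler_peMr // ler_pdivlMr ?powR_gt0 // mul1r.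
  by rewrite ge0_ler_powR ?nnegrE ?(ltW (w_gt0 _)) // ltW.
have [n N nA|C alphaC] := sum_le_of_differences A0 (powR_ge0 M p)
  (mulr_ge0 (powR_ge0 2 p) (powR_ge0 2 p)) alpha0 alphaM.
  apply: sum_visits_le nA => m mA; apply/ball_lpZ.
  exact: set_mem mA.
by exists C; exact: le_int_sum.
Qed.

End weighted_shift_iterates.

(** * The two one-sided series as one two-sided sum *)

Section weight_series.
Context (R : realType).

Lemma cvg_sum_from1 (f : nat -> R) : (forall n, 0 <= f n) ->
  cvgn (fun N => \sum_(1 <= n < N) f n) <->
  exists C, forall N, \sum_(n < N) f n <= C.
Proof.
move=> f0; have homo1 : {homo (fun N => \sum_(1 <= n < N) f n) :
    m n / (m <= n)%N >-> m <= n}.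
  move=> m n mn; have [m0|m1] := leqP m 1.
    by rewrite big_geq // sumr_ge0.
  by rewrite (big_cat_nat (ltnW m1) mn) /= lerDl sumr_ge0.
split=> [cvgf|[C fC]].
  exists (f 0 + limn (fun N => \sum_(1 <= n < N) f n)) => -[|N].
    rewrite big_ord0 addr_ge0 //.
    by have := nondecreasing_cvgn_le homo1 cvgf 1; rewrite big_geq.
  rewrite -(big_mkord xpredT f) big_ltn // lerD2l.
  exact: nondecreasing_cvgn_le homo1 cvgf N.+1.
apply: nondecreasing_is_cvgn => //; exists C => _ [N _ <-].
case: N => [|N]; first by have := fC 0; rewrite big_ord0 big_geq.
apply: le_trans _ (fC N.+1).
by rewrite -(big_mkord xpredT f) [leRHS]big_ltn // lerDr.
Qed.

(** On the negative side, [v (- (m + 1))] is the inverse of the product of [w 0] and the weights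
    from [w (-1)] to [w (-m)], so that half is the second series up to the positive factor (w
    0)^p. *)
Lemma weight_series_cvg (w : int -> R) (p : R) : (forall n, 0 < w n) ->
  (cvgn (fun N : nat =>
      \sum_(1 <= n < N) ((\prod_(1 <= i < n.+1) w i%:Z) `^ p)^-1) /\
    cvgn (fun N : nat =>
      \sum_(1 <= m < N) (\prod_(1 <= i < m.+1) w (- i%:Z)) `^ p)) <->
  exists C, forall N, int_sum (fun t => (weight_prod w t `^ p)^-1) N <= C.
Proof.
move=> w0; set alpha := (fun t => (weight_prod w t `^ p)^-1).
pose b m := (\prod_(1 <= i < m.+1) w (- i%:Z)) `^ p.
have alpha0 t : 0 <= alpha t by rewrite invr_ge0 powR_ge0.
have b0 m : 0 <= b m by exact: powR_ge0.
have prod0 m : 0 <= \prod_(1 <= i < m.+1) w (- i%:Z).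
  by rewrite prodr_ge0 // => i _; exact: ltW.
have alphaN m : alpha (Negz m) = w 0 `^ p * b m.
  rewrite /alpha /= big_ltn // oppr0 powRV ?mulr_ge0 ?(ltW (w0 _)) // invrK.
  by rewrite powRM ?(ltW (w0 _)).
have wp0 : 0 < w 0 `^ p by rewrite powR_gt0.
have sumE N : int_sum alpha N =
    \sum_(n < N) alpha (Posz n) + w 0 `^ p * \sum_(n < N) b n.
  rewrite /int_sum big_split /= mulr_sumr.
  by congr (_ + _); apply: eq_bigr => n _; rewrite alphaN.
rewrite (cvg_sum_from1 (f := fun n => alpha (Posz n))) // cvg_sum_from1 //.
split=> [[[C1 aC] [C2 bC]]|[C abC]].
  exists (C1 + w 0 `^ p * C2) => N.
  by rewrite sumE lerD // ler_wpM2l // ltW.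
split; [exists C|exists (C / w 0 `^ p)] => N.
  apply: le_trans _ (abC N).
  by rewrite sumE lerDl mulr_ge0 ?sumr_ge0 ?(ltW wp0).
rewrite ler_pdivlMr // mulrC; apply: le_trans _ (abC N).
by rewrite sumE lerDr sumr_ge0.
Qed.

End weight_series.

(** * A frequently hypercyclic vector *)

Section positions.
Local Open Scope nat_scope.

(** Every value of the 2-adic valuation occurs with positive density, yet its averages stay bounded,
    so positions can grow linearly. *)
Definition radius (k : nat) : nat := logn 2 k.+1.
(* As gap m > 2 * radius m, every point of the m-th block is further than
   radius m from the position of any other block. *)
Definition gap (k : nat) : nat := (radius k).*2.+1.

(** Closed form of the recursion in which consecutive positions differ by [gap k + gap k.+1]. *)
Definition position (k : nat) : nat := 2 * (\sum_(i < k) gap i) + gap k.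

Lemma position_gap k m : k < m -> position k + gap k + gap m <= position m.
Proof.
move=> km; rewrite /position -(subnKC km) big_split_ord big_ord_recr /=.
lia.
Qed.

Lemma logn2_fact_le n : logn 2 n`! <= n.
Proof.
rewrite logn_fact //.
(* The extra term [n %/ 2 ^ m] makes the bound on Legendre's sum inductive: it dominates twice the
   next quotient. *)
suff H m : \sum_(1 <= k < m.+1) n %/ 2 ^ k + n %/ 2 ^ m <= n.
  exact: leq_trans (leq_addr _ _) (H n).
elim: m => [|m IHm]; first by rewrite big_geq // expn0 divn1.
rewrite big_nat_recr //= -addnA; apply: leq_trans IHm; rewrite leq_add2l.
rewrite expnS mulnC divnMA addnn -muln2; exact: leq_trunc_div.
Qed.

(** The radii sum to the 2-adic valuation of a factorial, so the gaps up to index [k] sum to at most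
    [3 * k.+1]. *)
Lemma position_le k : position k <= 6 * k.+1.
Proof.
have radiusE n : \sum_(i < n) radius i = logn 2 n`!.
  elim: n => [|n IHn]; first by rewrite big_ord0.
  by rewrite big_ord_recr IHn factS lognM ?fact_gt0 //= addnC.
have : \sum_(i < k.+1) gap i <= 3 * k.+1.
  rewrite (eq_bigr (fun i : 'I_k.+1 => 2 * radius i + 1)).
    rewrite big_split -big_distrr /= radiusE sum1_card card_ord.
    by have := logn2_fact_le k.+1; lia.
  by move=> i _; rewrite /gap; lia.
by rewrite big_ord_recr /position /=; lia.
Qed.

Lemma logn_2_3 a b m (q := 2 ^ a * 3 ^ b * (6 * m).+1) :
  logn 2 q = a /\ logn 3 q = b.
Proof.
have m2 : logn 2 (6 * m).+1 = 0 by rewrite logn_coprime // coprime2n; lia.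
have m3 : logn 3 (6 * m).+1 = 0.
  by rewrite logn_coprime // prime_coprime //; lia.
rewrite /q !lognM ?muln_gt0 ?expn_gt0 // m2 m3 !lognX.
by rewrite !logn_prime //=; lia.
Qed.

(** The indices with [k.+1 = 2 ^ a * 3 ^ b * (6 * m + 1)] have the prescribed valuations and form an
    arithmetic progression; [position] grows linearly, so their positions keep positive lower
    density. *)
Lemma position_density (R : realType) (A : set nat) (a b : nat) :
    (forall k, radius k = a -> logn 3 k.+1 = b -> A (position k)) ->
  (0%R < lower_density R A)%E.
Proof.
(* 36 is the growth constant 6 of [position] times the 6 in [6 * m + 1]. *)
move=> Aab; pose q := 2 ^ a * 3 ^ b; pose Q := 36 * q.
have q0 : 0 < q by rewrite muln_gt0 !expn_gt0.
have Q0 : 0 < Q by rewrite muln_gt0.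
pose h m := (q * (6 * m).+1).-1.
have hS m : (h m).+1 = q * (6 * m).+1 by rewrite prednK // muln_gt0 q0.
have h_mono m n : m < n -> h m < h n 
  by move=> mn; rewrite -ltnS !hS ltn_pmul2l //; lia.
pose f m := position (h m).
have fA m : A (f m).
  by apply: Aab; rewrite /radius hS; have [] := logn_2_3 a b m.
have f_le m : f m <= Q * m.+1.
  by apply: leq_trans (position_le _) _; rewrite hS /Q; nia.
have f_mono m n : m < n -> f m < f n.
  by move=> /h_mono/position_gap; rewrite /f /gap; lia.
have f_inj : injective f.
  by move=> m n; have [/f_mono|/f_mono|//] := ltngtP m n; lia.
(* The factor 2 pays for rounding [N / Q] down once [N >= Q]. *)
apply: (@lower_density_gt0 _ _ (2 * Q%:R)^-1%R Q) => [|N QN].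
  by rewrite invr_gt0 mulr_gt0 ?ltr0n.
have count_ge : N %/ Q <= count_upto A N.
  have fN (m : 'I_(N %/ Q)) : f m < N.+1.
    rewrite ltnS (leq_trans (f_le m)) // (leq_trans _ (leq_trunc_div N Q)) //.
    by rewrite mulnC leq_mul2r ltn_ord orbT.
  rewrite /count_upto -[X in X <= _]card_ord.
  have fN_inj : injective (fun m => Ordinal (fN m)).
    by move=> m n [] /f_inj /val_inj.
  rewrite -(card_codom fN_inj); apply/subset_leq_card/fintype.subsetP.
  move=> _ /codomP[m ->]; rewrite inE /=; exact: fA.
have NQ : N <= 2 * Q * (N %/ Q).
  have := ltn_ceil N Q0; have : 0 < N %/ Q by rewrite divn_gt0.
  by nia.
rewrite mulrC ler_pdivrMr ?mulr_gt0 ?ltr0n // -!natrM ler_nat mulnC.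
by apply: leq_trans NQ _; rewrite leq_mul2l count_ge orbT.
Qed.

End positions.

(** * Finitely supported rational patterns *)

Section rational_scalars.
Context (R : realType) (k : scalars).

Definition scalar_of_rat (q : rat * rat) : Defs.scalar R k :=
  match k return Defs.scalar R k with
  | RealScalars => ratr q.1
  | ComplexScalars => (ratr q.1 +i* ratr q.2)%C
  end.

Lemma scalar_of_rat0 : scalar_of_rat (0, 0) = 0.
Proof. by rewrite /scalar_of_rat; case: k; rewrite /= ?rmorph0. Qed.

Lemma rat_near (x e : R) : 0 < e -> exists q : rat, `|x - ratr q| < e.
Proof.
move=> e0; have : x - e < x + e by lra.
move=> /rat_in_itvoo[q]; rewrite in_itv /= => /andP[xq qx].
by exists q; rewrite ltr_norml; apply/andP; split; lra.
Qed.

Lemma scalar_of_rat_near (z : Defs.scalar R k) (e : R) : 0 < e ->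
  exists q, modulus (z - scalar_of_rat q) < e.
Proof.
rewrite /scalar_of_rat /modulus; case: k z => [x|[x y]] e0.
  by have [q xq] := rat_near x e0; exists (q, 0).
have e20 : 0 < e / 2 by rewrite divr_gt0.
have [q xq] := rat_near x e20; have [r yr] := rat_near y e20.
exists (q, r) => /=; rewrite -[ltRHS]gtr0_norm // -[ltRHS]sqrtr_sqr.
rewrite ltr_sqrt ?exprn_gt0 // -(real_normK (num_real (x - _))).
rewrite -(real_normK (num_real (y - _))).
have := normr_ge0 (x - ratr q); have := normr_ge0 (y - ratr r).
move: xq yr; set X := `|x - _|; set Y := `|y - _|; nra.
Qed.

(** [unpickle] enumerates all pairs of finite sequences, one for each side of the origin; the
    default [(0, 0)] makes every pattern finitely supported. *)
Definition pattern (b : nat) (t : int) : Defs.scalar R k :=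
  if unpickle b is Some (s1, s2) then
    scalar_of_rat (match t with
      | Posz n => nth (0, 0) s1 n
      | Negz n => nth (0, 0) s2 n
      end)
  else 0.

Lemma pattern_of (T : nat) (q : int -> rat * rat) : exists b, forall t,
  pattern b t = if (int_index t < T)%N then scalar_of_rat (q t) else 0.
Proof.
exists (pickle (mkseq (fun n => q (Posz n)) T, mkseq (fun n => q (Negz n)) T)).
move=> t; rewrite /pattern pickleK.
case: t => n; rewrite /int_index; have [nT|Tn] := ltnP.
- by rewrite nth_mkseq.
- by rewrite nth_default ?size_mkseq // scalar_of_rat0.
- by rewrite nth_mkseq.
- by rewrite nth_default ?size_mkseq // scalar_of_rat0.
Qed.

End rational_scalars.

(** * The two-sided symbolic sequence and its growth *)

Section symbolic_sequence.
Context (R : realType) (k : scalars) (p : R) (g : nat -> R).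
Hypothesis p_gt0 : 0 < p.
Hypothesis g_ge0 : forall n, 0 <= g n.
Hypothesis g_homo : {homo g : m n / (m <= n)%N >-> m <= n}.
Local Notation K := (Defs.scalar R k).

Definition truncate (a : nat) (z : K) : K :=
  if modulus z `^ p <= g a then z else 0.

(* The k-th block shows the pattern number logn 3 k.+1 on the window of
   half-width radius k, its entries being limited by g (radius k); the radius
   and the pattern number take every pair of values for a set of k with
   positive lower density. *)
Definition symbolic (s : int) : K :=
  match pselect (exists m : nat, `|s - (position m)%:Z| <= (radius m)%:Z) with
  | left H => let m := sval (cid H) in
      truncate (radius m) (pattern R k (logn 3 m.+1) (s - (position m)%:Z))
  | right _ => 0
  end.

(** The windows are disjoint because [gap] exceeds [radius], so the index chosen by [cid] can only
    be [m]. *)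
Lemma symbolic_window (m : nat) (t : int) : `|t| <= (radius m)%:Z ->
  symbolic ((position m)%:Z + t) =
    truncate (radius m) (pattern R k (logn 3 m.+1) t).
Proof.
move=> tm; rewrite /symbolic; case: pselect => [H|[]]; last first.
  by exists m; rewrite [_ + t]addrC addrK.
case: cid => n /= tn; suff -> : n = m by rewrite [_ + t]addrC addrK.
have [/position_gap|/position_gap|//] := ltngtP n m; rewrite /gap; lia.
Qed.

Lemma modulus_truncate a (z : K) : modulus (truncate a z) `^ p <= g a.
Proof.
rewrite /truncate; case: ifP => // _.
by rewrite modulus0 powR0 ?gt_eqF.
Qed.

Lemma symbolicP (s : int) : symbolic s = 0 \/
  exists2 m : nat, `|s - (position m)%:Z| <= (radius m)%:Z &
    modulus (symbolic s) `^ p <= g (radius m).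
Proof.
rewrite /symbolic; case: pselect => [H|]; [right|by left].
by case: cid => m /= sm; exists m => //; exact: modulus_truncate.
Qed.

(** As [position m] exceeds twice [radius m], every point of the window of block [m] has index at
    least [radius m]. *)
Lemma symbolic_growth0 (t : int) :
  modulus (symbolic t) `^ p <= g (int_index t).
Proof.
have [->|[m tm /le_trans]] := symbolicP t.
  by rewrite modulus0 powR0 ?gt_eqF.
apply; apply: g_homo; move: tm; rewrite /position /gap.
by case: t => n /=; rewrite ?NegzE; lia.
Qed.

Lemma symbolic_growth (m T : nat) (t : int) :
    (forall t, (T <= int_index t)%N -> pattern R k (logn 3 m.+1) t = 0) ->
    (T <= int_index t)%N ->
  modulus (symbolic ((position m)%:Z + t)) `^ p <= g (int_index t).
Proof.
move=> pT Tt; have [tm|tm] := boolP (`|t| <= (radius m)%:Z).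
  rewrite symbolic_window // pT // /truncate if_same.
  by rewrite modulus0 powR0 ?gt_eqF.
have [->|[n tn /le_trans]] := symbolicP ((position m)%:Z + t).
  by rewrite modulus0 powR0 ?gt_eqF.
apply; apply: g_homo.
(* The two positions are at least [gap m + gap n] apart, so a point in the window of block [n] is
   further than [radius n] from [position m]. *)
have [mn|nm|mn] := ltngtP m n.
- move: tn (position_gap mn); rewrite /gap.
  by case: t {Tt tm} => i /=; rewrite ?NegzE; lia.
- move: tn (position_gap nm); rewrite /gap.
  by case: t {Tt tm} => i /=; rewrite ?NegzE; lia.
- by move: tn tm; rewrite mn; lia.
Qed.

End symbolic_sequence.

(** * Frequent hypercyclicity from the symbolic sequence *)

Section sufficiency.
Context (R : realType).

Lemma ler_int_sum (F G : int -> R) (N : nat) : (forall t, F t <= G t) ->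
  int_sum F N <= int_sum G N.
Proof. by move=> FG; apply: ler_sum => n _; rewrite lerD. Qed.

Lemma int_sumD (F G : int -> R) (N : nat) :
  int_sum (fun t => F t + G t) N = int_sum F N + int_sum G N.
Proof. by rewrite /int_sum -big_split; apply: eq_bigr => n _ /=; ring. Qed.

Lemma int_sumZ (c : R) (F : int -> R) (N : nat) :
  int_sum (fun t => c * F t) N = c * int_sum F N.
Proof.
by rewrite /int_sum mulr_sumr; apply: eq_bigr => n _; rewrite mulrDr.
Qed.

Lemma powRD_le (p a b : R) : 0 <= p -> 0 <= a -> 0 <= b ->
  (a + b) `^ p <= 2 `^ p * (a `^ p + b `^ p).
Proof.
move=> p0; wlog ab : a b / a <= b => [H a0 b0|a0 b0].
  have [/H|/ltW/H] := leP a b; first exact.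
  by rewrite [a + b]addrC [a `^ p + _]addrC; exact.
apply: (@le_trans _ _ ((2 * b) `^ p)).
  by rewrite ge0_ler_powR ?nnegrE ?addr_ge0 ?mulr_ge0 //; lra.
by rewrite powRM // ler_wpM2l ?powR_ge0 // lerDr powR_ge0.
Qed.

Context (k : scalars) (p : R) (p1 : 1 <= p) (w : int -> R).
Hypotheses (w_gt0 : forall n, 0 < w n) (w_bnd : exists M, forall n, w n <= M).
Local Notation K := (Defs.scalar R k).
Local Notation X := (lpZ k p1).
Local Notation B := (weighted_shift k p1 w_gt0 w_bnd).
Local Notation v := (weight_prod w).
Local Notation alpha := (fun t => (v t `^ p)^-1).

Let p_gt0 : 0 < p := lt_le_trans ltr01 p1.

Lemma modulus_unweight (t : int) (z : K) :
  modulus (of_real k (v t)^-1 * z) `^ p = modulus z `^ p * alpha t.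
Proof.
have v0 := weight_prod_gt0 w_gt0 t.
rewrite modulusM modulus_of_real ger0_norm ?invr_ge0 ?(ltW v0) //.
by rewrite powRM ?invr_ge0 ?modulus_ge0 ?(ltW v0) // powRV ?(ltW v0) // mulrC.
Qed.

Lemma lpZ_energy_le_int_sum (x : int -> K) (C : R) :
    (forall N, int_sum (fun t => modulus (x t) `^ p) N <= C) ->
  (lpZ_energy p x <= C%:E)%E.
Proof. by move=> xC; apply: esum_int_le => // t; exact: powR_ge0. Qed.

Lemma frequently_hypercyclic_weighted_shift :
  (exists C, forall N, int_sum alpha N <= C) -> frequently_hypercyclic R B.
Proof.
move=> [C alphaC].
have v0 s : 0 < v s by rewrite weight_prod_gt0.
have alpha_gt0 t : 0 < alpha t by rewrite invr_gt0 powR_gt0.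
have [g [g0 g_homo g_unbounded [C' gC']]] :=
  unbounded_summable_weight
    (fun n => addr_gt0 (alpha_gt0 (Posz n)) (alpha_gt0 (Negz n))) alphaC.
pose W t := g (int_index t) * alpha t.
have W0 t : 0 <= W t by rewrite mulr_ge0 // ltW.
have WC' N : int_sum W N <= C'.
  apply: le_trans (gC' N); rewrite le_eqVlt; apply/orP; left; apply/eqP.
  by apply: eq_bigr => n _; rewrite mulrDr.
(* The growth bound on [y] makes [W] a summable majorant of the p-th powers of the entries of
   [y / v]. *)
pose y := symbolic k p g.
pose xf t := of_real k (v t)^-1 * y t.
have x_mem : xf \in @lpZ_pred R k p.
  rewrite lpZ_predE.
  apply: le_lt_trans (lpZ_energy_le_int_sum _) (ltry C') => N.
  apply: le_trans (ler_int_sum _ _) (WC' N) => t.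
  by rewrite modulus_unweight ler_wpM2r ?(ltW (alpha_gt0 _)) ?symbolic_growth0.
pose x : X := LpZ p1 x_mem.
have iter_x n t : iter n B x t = of_real k (v t)^-1 * y (n%:Z + t).
  rewrite iter_weighted_shift.
  rewrite -[x _]/(of_real k (v (t + n%:Z))^-1 * y (t + n%:Z)).
  rewrite mulrA -of_realM [t + _]addrC; congr (of_real k _ * _).
  by field; rewrite !gt_eqF.
exists x => U oU [z Uz].
have /nbhs_ballP [e' /= e'0 zU] : nbhs z U by exact: open_nbhs_nbhs.
pose e := modulus e'.
have e'E : e' = of_real k e by rewrite of_real_modulus gtr0_norm.
have e0 : 0 < e by rewrite -(of_real_gt0 k) -e'E.
(* [G] bounds the p-th power of the error outside the pattern at every intended visit time; it does
   not depend on that time, so [T] can be fixed first. *)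
pose G t := 2 `^ p * (modulus (z t) `^ p + W t).
have G0 t : 0 <= G t by rewrite mulr_ge0 ?addr_ge0 ?powR_ge0.
have GC N : int_sum G N <= 2 `^ p * (lpZ_norm z `^ p + C').
  rewrite int_sumZ int_sumD ler_wpM2l ?powR_ge0 // lerD //.
  by apply: le_int_sum => S; exact: sum_le_lpZ_norm.
have ep0 : 0 < (e / 2) `^ p / 2 by rewrite divr_gt0 ?powR_gt0 ?divr_gt0.
have [T GT] := int_sum_tail G0 GC ep0.
(* Summed against [alpha], [c] uses at most half of (e/2)^p, the tail taking the other half; the
   maximum with 1 keeps the denominator positive. *)
pose c := (e / 2) `^ p / 2 / Num.max C 1.
have C1 : 0 < Num.max C 1 by rewrite lt_max ltr01 orbT.
have c0 : 0 < c by rewrite divr_gt0.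
(* The approximation to within c^(1/p) precedes the division by [v], after which the p-th power of
   the error is at most [c * alpha t]. *)
have [q qz] := choice (fun t : int => scalar_of_rat_near (of_real k (v t) * z t)
  (powR_gt0 p^-1 c0)).
have [b bq] := pattern_of R k T q.
pose Q t := modulus (scalar_of_rat R k (q t)) `^ p.
(* A radius of at least [a0] leaves every entry of the pattern untruncated, and one of at least [T]
   makes the window contain its support. *)
have [a0 ga0] := g_unbounded (int_sum Q T).
pose a := maxn a0 T.
apply: (@position_density R _ a b) => m ma mb; apply: zU; rewrite e'E.
apply/ball_lpZ; apply: (@le_lt_trans _ _ (e / 2)); last first.
  by rewrite ltr_pdivrMr ?ltr_pMr ?ltr1n.
apply: lpZ_norm_le; first by rewrite divr_ge0 // ltW.
apply: lpZ_energy_le_int_sum => N.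
pose F t := c * alpha t + (if (int_index t < T)%N then 0 else G t).
apply: (@le_trans _ _ (int_sum F N)); last first.
  rewrite int_sumD int_sumZ [leRHS]splitr lerD // -ler_pdivlMl //.
  rewrite /c invf_div mulfVK ?gt_eqF //.
  by apply: le_trans (alphaC N) _; rewrite le_max lexx.
apply: ler_int_sum => t; rewrite lpZ_val_sub iter_x /F.
have [tT|Tt] := ltnP.
  have -> : y ((position m)%:Z + t) = scalar_of_rat R k (q t).
    rewrite /y symbolic_window // ?mb ?bq ?tT; last first.
      by rewrite ma /a; move: tT; case: t => n /=; rewrite ?NegzE; lia.
    rewrite /truncate ifT // ma; apply: le_trans (g_homo _ _ (leq_maxl a0 T)).
    apply: le_trans ga0.
    have := @sum_le_int_sum _ Q [:: t] T; rewrite big_seq1; apply=> //.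
      by move=> s; exact: powR_ge0.
    by move=> s; rewrite inE => /eqP ->.
  have -> : z t - of_real k (v t)^-1 * scalar_of_rat R k (q t) =
      of_real k (v t)^-1 * (of_real k (v t) * z t - scalar_of_rat R k (q t)).
    by rewrite mulrBr mulrA -of_realM mulVf ?gt_eqF // of_real1 mul1r.
  rewrite modulus_unweight addr0 ler_wpM2r ?(ltW (alpha_gt0 _)) //.
  apply: (@le_trans _ _ ((c `^ p^-1) `^ p)).
    rewrite ge0_ler_powR ?nnegrE ?modulus_ge0 ?powR_ge0 ?(ltW p_gt0) //.
    exact: ltW (qz t).
  by rewrite -powRrM mulVf ?gt_eqF // powRr1 // ltW.
rewrite -[leLHS]add0r lerD //; first by rewrite mulr_ge0 ?ltW.
apply: (@le_trans _ _ ((modulus (z t) +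
    modulus (of_real k (v t)^-1 * y ((position m)%:Z + t))) `^ p)).
  rewrite ge0_ler_powR ?nnegrE ?addr_ge0 ?modulus_ge0 ?(ltW p_gt0) //.
  by rewrite -[X in _ <= _ + X]modulusN ler_modulusD.
apply: le_trans (powRD_le _ _ _) _; rewrite ?modulus_ge0 ?(ltW p_gt0) //.
rewrite ler_wpM2l ?powR_ge0 // lerD2l modulus_unweight.
rewrite ler_wpM2r ?(ltW (alpha_gt0 _)) //.
apply: symbolic_growth Tt => // s Ts.
by rewrite mb bq ltnNge Ts.
Qed.

End sufficiency.

Theorem theorem3 (R : realType) (k : scalars) (p : R) (p1 : 1 <= p)
    (w : int -> R) (w_gt0 : forall n : int, 0 < w n)
    (w_bnd : exists M : R, forall n : int, w n <= M) :
  (frequently_hypercyclic R (weighted_shift k p1 w_gt0 w_bnd) <->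
   U_frequently_hypercyclic R (weighted_shift k p1 w_gt0 w_bnd)) /\
  (U_frequently_hypercyclic R (weighted_shift k p1 w_gt0 w_bnd) <->
   (cvgn (fun N : nat =>
      \sum_(1 <= n < N) ((\prod_(1 <= i < n.+1) w i%:Z) `^ p)^-1) /\
    cvgn (fun N : nat =>
      \sum_(1 <= m < N) (\prod_(1 <= i < m.+1) w (- i%:Z)) `^ p))).
Proof.
rewrite weight_series_cvg //.
have F_U : frequently_hypercyclic R (weighted_shift k p1 w_gt0 w_bnd) ->
    U_frequently_hypercyclic R (weighted_shift k p1 w_gt0 w_bnd).
  move=> [x xF]; exists x => U oU U0.
  exact: lt_le_trans (xF U oU U0) (limn_einf_sup _).
have U_iii := @weight_prod_sum_le R k p p1 w w_gt0 w_bnd.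
have iii_F := @frequently_hypercyclic_weighted_shift R k p p1 w w_gt0 w_bnd.
split; split; [exact: F_U|by move=> /U_iii/iii_F|exact: U_iii|].
by move=> /iii_F/F_U.
Qed.
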